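(* Let $H\in\mathbb{R}^{n\times n}$ be symmetric positive semidefinite, $c\in\mathbb{R}^n$, $A\in\mathbb{R}^{m\times n}$, $b\in\mathbb{R}^m$, $\beta>0$, and let $n=p\,s$ with positive integers $p,s$. Assume that for every index block $\omega\subseteq\{1,\dots,n\}$ with $|\omega|=s$ one has $H_{\omega,\omega}+\beta A_\omega^TA_\omega\succ 0$. Let $z^k=(x^k;y^k)$, $k\ge0$, be the random sequence generated by RAC-ADMM with $p$ blocks of size $s$ and penalty parameter $\beta$ (as defined in the context), started from an arbitrary deterministic $z^0\in\mathbb{R}^{n+m}$, applied to the problem $$\min_{x\in\mathbb{R}^n}\ \tfrac12 x^THx+c^Tx\quad\text{s.t. } Ax=b .$$ If $$\rho\big(\mathbb{E}_\sigma(M_\sigma\otimes M_\sigma)\big)<1,$$ where $M_\sigma$ is the RAC-ADMM mapping matrix, $\sigma$ is uniformly distributed on $\Gamma_{RAC(n,p)}$, $\otimes$ is the Kronecker product and $\rho$ is the spectral radius, then $z^k$ converges almost surely, as $k\to\infty$, to some KKT point of the problem.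
   Context: For an index block $\omega$, $A_\omega$ is the submatrix of $A$ formed by the columns indexed by $\omega$, and $H_{\omega,\omega'}$ is the submatrix of $H$ with rows in $\omega$ and columns in $\omega'$. A KKT point of the problem is a pair $(x,y)\in\mathbb{R}^n\times\mathbb{R}^m$ with $Hx+c-A^Ty=0$ and $Ax=b$. Augmented Lagrangian: $L_\beta(x,y)=\tfrac12x^THx+c^Tx-y^T(Ax-b)+\tfrac{\beta}{2}\|Ax-b\|^2$. Updating orders: $\Gamma_{RAC(n,p)}$ is the set of all ordered partitions $\sigma=(\sigma_1,\dots,\sigma_p)$ of $\{1,\dots,n\}$ into $p$ blocks of size $s$ each; $|\Gamma_{RAC(n,p)}|=n!/(s!)^p$. RAC-ADMM (randomly assembled cyclic ADMM): at each iteration $k$, draw $\sigma\in\Gamma_{RAC(n,p)}$ uniformly at random, independently of the previous iterations. Then, for $i=1,\dots,p$ successively, update block $\sigma_i$ by setting $x_{\sigma_i}^{k+1}$ to be the minimizer over $x_{\sigma_i}\in\mathbb{R}^s$ of $L_\beta(\cdot\,;y^k)$, where the blocks $\sigma_1,\dots,\sigma_{i-1}$ are fixed at their new values $x^{k+1}$ and the blocks $\sigma_{i+1},\dots,\sigma_p$ at their old values $x^k$. Finally set $y^{k+1}=y^k-\beta(Ax^{k+1}-b)$. Matrix form: let $S=H+\beta A^TA$. For $\sigma\in\Gamma_{RAC(n,p)}$ let $L_\sigma\in\mathbb{R}^{n\times n}$ be given blockwise by $(L_\sigma)_{\sigma_i,\sigma_j}=H_{\sigma_i,\sigma_j}+\beta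 A_{\sigma_i}^TA_{\sigma_j}$ if $i\ge j$ and $0$ otherwise, and let $R_\sigma=L_\sigma-S$. Set $$\bar L_\sigma=\begin{bmatrix}L_\sigma&0\\ \beta A&I\end{bmatrix},\quad \bar R_\sigma=\begin{bmatrix}R_\sigma&A^T\\0&I\end{bmatrix},\quad \bar b=\begin{bmatrix}-c+\beta A^Tb\\ \beta b\end{bmatrix},\quad M_\sigma=\bar L_\sigma^{-1}\bar R_\sigma .$$ Then one RAC-ADMM iteration with order $\sigma$ is $z^{k+1}=M_\sigma z^k+\bar L_\sigma^{-1}\bar b$. *)

(* Defs.v *)
From HB Require Import structures.
From mathcomp Require Import all_boot all_order all_algebra.
From mathcomp Require Import finmap.
From mathcomp Require Export complex mxtens.
From mathcomp Require Import all_classical all_reals all_analysis.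

Set Implicit Arguments.
Unset Strict Implicit.
Unset Printing Implicit Defensive.

Import Order.TTheory GRing.Theory Num.Theory.
Import numFieldNormedType.Exports.

Local Open Scope classical_set_scope.
Local Open Scope ring_scope.

Section Matrices.
Context {R : realType}.

Definition scal (M : 'M[R]_1) : R := M ord0 ord0.

Definition psdmx k (Q : 'M[R]_k) : Prop :=
  Q^T = Q /\ forall v : 'cV[R]_k, 0 <= scal (v^T *m Q *m v).

Definition pdmx k (Q : 'M[R]_k) : Prop :=
  Q^T = Q /\ forall v : 'cV[R]_k, v != 0 -> 0 < scal (v^T *m Q *m v).

(* The set is empty only when k = 0; otherwise it is finite and nonempty, so
   that its supremum is the largest modulus of a complex eigenvalue. *)
Definition spectral_radius k (M : 'M[R]_k) : R :=
  sup [set ComplexField.Normc.normc l | l in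
        [set l : R[i] | eigenvalue (map_mx (real_complex R) M) l]].

Definition cols_of m n (w : {set 'I_n}) (A : 'M[R]_(m, n)) : 'M[R]_(m, #|w|) :=
  colsub (fun a : 'I_#|w| => enum_val a) A.

Definition diag_block n (w : {set 'I_n}) (H : 'M[R]_n) : 'M[R]_#|w| :=
  mxsub (fun a : 'I_#|w| => enum_val a) (fun a : 'I_#|w| => enum_val a) H.

End Matrices.

(* A map from block positions to blocks is an ordered p-tuple of blocks. *)
Definition ordering (n p : nat) : finType := {ffun 'I_p -> {set 'I_n}}.

Definition Gamma_RAC (n p s : nat) : {set ordering n p} :=
  [set sg : ordering n p |
     [&& [forall i, #|sg i| == s],
         [forall i, forall j, (i != j) ==> [disjoint sg i & sg j]] &
         \bigcup_i sg i == [set: 'I_n]]]%SET.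

Section QP.
Context {R : realType} {n m : nat}.
Variables (H : 'M[R]_n) (c : 'cV[R]_n) (A : 'M[R]_(m, n)) (b : 'cV[R]_m).

Definition KKT_point (z : 'cV[R]_n * 'cV[R]_m) : Prop :=
  H *m z.1 + c - A^T *m z.2 = 0 /\ A *m z.1 = b.

Variable beta : R.

(* The Euclidean norm is spelled out because `|_| on matrices is the
   sup norm. *)
Definition aug_Lagrangian (x : 'cV[R]_n) (y : 'cV[R]_m) : R :=
  2^-1 * scal (x^T *m H *m x) + scal (c^T *m x)
  - scal (y^T *m (A *m x - b))
  + beta / 2 * scal ((A *m x - b)^T *m (A *m x - b)).

Section Order.
Context {p : nat}.
Variable sg : ordering n p.

(* blocks sg_0, ..., sg_i at their values in x', later blocks as in x *)
Definition sweep (x x' : 'cV[R]_n) (i : 'I_p) : 'cV[R]_n :=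
  \col_u (if [exists j : 'I_p, (j <= i)%N && (u \in sg j)]
          then x' u ord0 else x u ord0).

Definition block_minimizer (w : {set 'I_n}) (x : 'cV[R]_n) (y : 'cV[R]_m) :
    Prop :=
  forall v : 'cV[R]_n, (forall u, u \notin w -> v u ord0 = x u ord0) ->
    aug_Lagrangian x y <= aug_Lagrangian v y.

Definition RAC_ADMM_step (z z' : 'cV[R]_n * 'cV[R]_m) : Prop :=
  (forall i : 'I_p, block_minimizer (sg i) (sweep z.1 z'.1 i) z.2) /\
  z'.2 = z.2 - beta *: (A *m z'.1 - b).

Definition L_mx : 'M[R]_n :=
  \matrix_(u, v) (if [exists i : 'I_p, exists j : 'I_p,
                        [&& u \in sg i, v \in sg j & (j <= i)%N]]
                  then H u v + beta * (A^T *m A) u v else 0).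

Definition R_mx : 'M[R]_n := L_mx - (H + beta *: (A^T *m A)).

Definition Lbar_mx : 'M[R]_(n + m) := block_mx L_mx 0 (beta *: A) 1%:M.

Definition Rbar_mx : 'M[R]_(n + m) := block_mx R_mx A^T 0 1%:M.

Definition M_mx : 'M[R]_(n + m) := invmx Lbar_mx *m Rbar_mx.

End Order.

Definition E_MM (p s : nat) : 'M[R]_((n + m) * (n + m)) :=
  (#|Gamma_RAC n p s|%:R)^-1 *:
    \sum_(sg in Gamma_RAC n p s) (M_mx sg *t M_mx sg).

End QP.

Section Randomness.
Context {R : realType} {d : measure_display} {T : measurableType d}.
Variable P : probability T R.

Definition mutually_independent (I : finType) (X : nat -> T -> I) : Prop :=
  forall (J : {fset nat}) (B : nat -> set I),
    P (\bigcap_(k in [set` J]) (X k @^-1` B k)) =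
    (\prod_(k <- J) P (X k @^-1` B k))%E.

Definition iid_uniform (I : finType) (G : {set I}) (X : nat -> T -> I) : Prop :=
  [/\ forall k t, X k t \in G,
      forall k g, measurable (X k @^-1` [set g]),
      forall k g, g \in G -> P (X k @^-1` [set g]) = ((#|G|%:R)^-1)%:E
    & mutually_independent X].

Definition RAC_ADMM_process n m (H : 'M[R]_n) (c : 'cV[R]_n)
    (A : 'M[R]_(m, n)) (b : 'cV[R]_m) (beta : R) (p s : nat)
    (z0 : 'cV[R]_n * 'cV[R]_m) (z : nat -> T -> 'cV[R]_n * 'cV[R]_m) : Prop :=
  exists sg : nat -> T -> ordering n p,
    [/\ iid_uniform (Gamma_RAC n p s) sg,
        forall t, z 0%N t = z0
      & forall k t, RAC_ADMM_step H c A b beta (sg k t) (z k t) (z k.+1 t)].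

End Randomness.

(* Main.v *)
(* The error z^k - z^* is a product of i.i.d. matrices M_sigma applied to the
   initial error e, so the expected tensor square of the error is Q^k (e (x) e)
   with Q = E(M_sigma (x) M_sigma).  As rho(Q) < 1, the entries of these vectors
   are summable in k; in particular so are the second moments of the
   coordinates of the error.  By Tonelli the squared coordinates are almost
   surely summable, hence tend to 0.  The same spectral condition makes the KKT
   matrix invertible, which provides z^*. *)
Require Import Defs.
From HB Require Import structures.
From mathcomp Require Import all_boot all_order all_algebra.
From mathcomp Require Import finmap.
From mathcomp Require Import all_classical all_reals all_analysis.
From mathcomp Require Import measurable_realfun ring lra.
Import Order.TTheory GRing.Theory Num.Theory.
Import numFieldNormedType.Exports.
Local Open Scope classical_set_scope.
Local Open Scope ring_scope.

Set Implicit Arguments.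
Unset Strict Implicit.
Unset Printing Implicit Defensive.

(** * Summability of the powers of a matrix of spectral radius below 1 *)

Section PowerSummability.
Context {R : realType}.
Local Notation C := R[i].
Local Notation normc := (@ComplexField.Normc.normc R).

Lemma normc_ge0 (x : C) : 0 <= normc x.
Proof. by case: x => a b; exact: sqrtr_ge0. Qed.

Lemma normc_real (x : R) : normc (real_complex R x) = `|x|.
Proof. by rewrite /= expr0n addr0 sqrtr_sqr. Qed.

(** [sup] dominates the members of a set only when the set is bounded above. The eigenvalues are
    roots of the characteristic polynomial, so the sum of the moduli of all its roots is a bound. *)
Lemma normc_le_spectral_radius N (Q : 'M[R]_N) (l : C) :
  eigenvalue (map_mx (real_complex R) Q) l -> normc l <= spectral_radius Q.
Proof.
move=> Ql; apply: ub_le_sup; last by exists l.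
have [rs charQ] := closed_field_poly_normal (char_poly (map_mx (real_complex R) Q)).
exists (\sum_(r <- rs) normc r) => _ [r rQ <-].
move: rQ; rewrite /= eigenvalue_root_char charQ (monicP (char_poly_monic _)).
rewrite scale1r root_prod_XsubC => r_rs.
by rewrite (big_rem r) //= lerDl sumr_ge0 // => ? _; exact: normc_ge0.
Qed.

(* Each factor is removed by solving u_(k+1) = r u_k + w_k, with w summable by
   induction and |r| < 1. *)
Lemma summable_orbit_of_annihilator N (Q : 'M[C]_N) (rs : seq C) (v : 'cV[C]_N) :
  (forall r, r \in rs -> normc r < 1) ->
  foldl (fun u r => (Q - r%:M) *m u) v rs = 0 ->
  forall i, exists B, forall K,
    \sum_(0 <= k < K) normc (iter k (mulmx Q) v i ord0) <= B.
Proof.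
elim: rs v => [|r rs IH] v lt1 /= annv i.
  exists 0 => K; rewrite big1 // => k _.
  have -> : iter k (mulmx Q) v = 0.
    by elim: k => //= k ->; rewrite mulmx0.
  by rewrite mxE ComplexField.Normc.normc0.
have [|B sumB] := IH _ _ annv i.
  by move=> r' r'rs; apply: lt1; rewrite inE r'rs orbT.
have r1 : normc r < 1 by apply: lt1; rewrite inE eqxx.
have w k : iter k (mulmx Q) ((Q - r%:M) *m v) =
    iter k.+1 (mulmx Q) v - r *: iter k (mulmx Q) v.
  elim: k => [|k IHk]; first by rewrite /= mulmxBl mul_scalar_mx.
  by rewrite iterS IHk mulmxBr -scalemxAr.
set a := fun k => normc (iter k (mulmx Q) v i ord0).
have a_ge0 k : 0 <= a k by exact: normc_ge0.
(* Summing |u_(k+1)| <= |w_k| + |r| |u_k| gives S <= a 0 + B + |r| S for every partial sum S; the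
   bound is this inequality solved for S. *)
exists ((a 0%N + B) / (1 - normc r)) => K.
rewrite ler_pdivlMr ?subr_gt0 //.
have step k : a k.+1 <= normc (iter k (mulmx Q) ((Q - r%:M) *m v) i ord0)
                        + normc r * a k.
  rewrite /a -ComplexField.Normc.normcM.
  have -> : iter k.+1 (mulmx Q) v i ord0 =
      iter k (mulmx Q) ((Q - r%:M) *m v) i ord0 + r * iter k (mulmx Q) v i ord0.
    by rewrite w !mxE subrK.
  exact: le_normcD.
have sumS : \sum_(0 <= k < K.+1) a k <=
    a 0%N + (B + normc r * \sum_(0 <= k < K) a k).
  rewrite big_nat_recl // lerD2l.
  apply: le_trans (lerD (sumB K) (lexx _)).
  by rewrite mulr_sumr -big_split /=; apply: ler_sum => k _; exact: step.
have : \sum_(0 <= k < K) a k <= \sum_(0 <= k < K.+1) a k.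
  by rewrite big_nat_recr //= lerDl.
move=> /le_trans /(_ sumS); rewrite mulrBr mulr1 lerBlDr [_ * normc r]mulrC.
by rewrite addrA.
Qed.

Lemma foldl_XsubC_horner N (Q : 'M[C]_N.+1) (rs : seq C) (v : 'cV[C]_N.+1) :
  foldl (fun u r => (Q - r%:M) *m u) v rs =
  horner_mx Q (\prod_(r <- rs) ('X - r%:P)) *m v.
Proof.
elim: rs v => [|r rs IH] v /=; first by rewrite big_nil rmorph1 mul1mx.
rewrite IH big_cons mulrC rmorphM /= rmorphB /= horner_mx_X horner_mx_C.
by rewrite -mulmxE mulmxA.
Qed.

(** Over the complex numbers the characteristic polynomial splits into linear factors whose roots
    have modulus below 1, and by Cayley-Hamilton their product annihilates every vector. *)
Lemma summable_orbit N (Q : 'M[R]_N) (v : 'cV[R]_N) (i : 'I_N) :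
  spectral_radius Q < 1 ->
  exists B, forall K, \sum_(0 <= k < K) `|iter k (mulmx Q) v i ord0| <= B.
Proof.
case: N Q v i => [|N] Q v i rhoQ; first by case: i.
set QC := map_mx (real_complex R) Q.
have [rs] := closed_field_poly_normal (char_poly QC).
rewrite (monicP (char_poly_monic _)) scale1r => charQ.
have [||B sumB] := @summable_orbit_of_annihilator _ QC rs
    (map_mx (real_complex R) v) _ _ i.
- move=> r r_rs; apply: le_lt_trans rhoQ; apply: normc_le_spectral_radius.
  by rewrite eigenvalue_root_char charQ root_prod_XsubC.
- by rewrite foldl_XsubC_horner -charQ Cayley_Hamilton mul0mx.
exists B => K; apply: le_trans (sumB K).
rewrite le_eqVlt; apply/orP; left; apply/eqP/eq_bigr => k _.
have -> : iter k (mulmx QC) (map_mx (real_complex R) v) =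
    map_mx (real_complex R) (iter k (mulmx Q) v).
  by elim: k => //= k ->; rewrite -map_mxM.
by rewrite [in RHS]mxE normc_real.
Qed.
End PowerSummability.

(** * Linear algebra: trivial kernels and the dot product *)

Lemma unitmx_ker0 (F : fieldType) k (Q : 'M[F]_k) :
  (forall v : 'cV_k, Q *m v = 0 -> v = 0) -> Q \in unitmx.
Proof.
(* [kermx] is a left kernel, hence the passage to the transpose. *)
move=> inj; rewrite -unitmx_tr -row_free_unit -kermx_eq0.
apply/eqP/row_matrixP => i; rewrite row0.
apply: trmx_inj; rewrite trmx0; apply: inj; apply: trmx_inj.
by rewrite trmx_mul trmxK trmx0 -row_mul mulmx_ker row0.
Qed.

Section DotProduct.
Context {R : realType}.
Implicit Types (k l : nat).

Definition dot k (u v : 'cV[R]_k) : R := scal (u^T *m v).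

Lemma dotC k (u v : 'cV_k) : dot u v = dot v u.
Proof. by rewrite /dot /scal -[in LHS](trmxK v) -trmx_mul mxE. Qed.

Lemma dotDl k (u v w : 'cV_k) : dot (u + v) w = dot u w + dot v w.
Proof. by rewrite /dot /scal raddfD mulmxDl mxE. Qed.

Lemma dotDr k (u v w : 'cV_k) : dot w (u + v) = dot w u + dot w v.
Proof. by rewrite dotC dotDl !(dotC w). Qed.

Lemma dotZl k a (u v : 'cV_k) : dot (a *: u) v = a * dot u v.
Proof. by rewrite /dot /scal [(a *: u)^T]linearZ -scalemxAl mxE. Qed.

Lemma dotZr k a (u v : 'cV_k) : dot u (a *: v) = a * dot u v.
Proof. by rewrite dotC dotZl dotC. Qed.

Lemma dotNr k (u v : 'cV_k) : dot u (- v) = - dot u v.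
Proof. by rewrite -scaleN1r dotZr mulN1r. Qed.

Lemma dotNl k (u v : 'cV_k) : dot (- u) v = - dot u v.
Proof. by rewrite dotC dotNr dotC. Qed.

Lemma dot_trmx k l (B : 'M[R]_(k, l)) u v : dot u (B *m v) = dot (B^T *m u) v.
Proof. by rewrite /dot trmx_mul trmxK mulmxA. Qed.

Lemma dot_delta k (u : 'I_k) (v : 'cV_k) : dot (delta_mx u ord0) v = v u ord0.
Proof. by rewrite /dot /scal trmx_delta -rowE mxE. Qed.

(** First-order optimality without derivatives: with M = |a| + 1 > a, the value at t = - g / M is (g
    / M)^2 (a - M), which is negative unless g = 0. *)
Lemma quadratic_ge0_linear0 (g a : R) : (forall t, 0 <= t * g + t ^+ 2 * a) -> g = 0.
Proof.
move=> ge0; apply/eqP; apply: contraT => g0.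
have M0 : 0 < `|a| + 1 by rewrite ltr_wpDl.
have := ge0 (- (g / (`|a| + 1))).
have -> : - (g / (`|a| + 1)) * g + (- (g / (`|a| + 1))) ^+ 2 * a =
    (g / (`|a| + 1)) ^+ 2 * (a - (`|a| + 1)).
  by field; rewrite gt_eqF.
have sq0 : 0 < (g / (`|a| + 1)) ^+ 2.
  by rewrite exprn_even_gt0 //= mulf_neq0 // invr_eq0 gt_eqF.
by rewrite pmulr_rge0 // subr_ge0 => /le_lt_trans/(_ (ltr_pwDr ltr01 (ler_norm a)));
  rewrite ltxx.
Qed.
End DotProduct.

(** * One RAC-ADMM iteration as a linear system *)

Section Algebra.
Context {R : realType} {n m : nat}.
Variables (H : 'M[R]_n) (c : 'cV[R]_n) (A : 'M[R]_(m, n)) (b : 'cV[R]_m).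
Variable beta : R.
Hypothesis H_sym : H^T = H.
Local Notation S := (H + beta *: (A^T *m A)).
Local Notation aug := (aug_Lagrangian H c A b beta).

Definition aug_grad x y : 'cV[R]_n := S *m x + c - A^T *m y - beta *: (A^T *m b).

(** The Taylor expansion of a quadratic is exact. Symmetry of [H] merges the two cross terms, so
    that [aug_grad] is the gradient in x. *)
Lemma aug_LagrangianD x d y :
  aug (x + d) y = aug x y + dot d (aug_grad x y) + 2^-1 * dot d (S *m d).
Proof.
have augE v : aug v y = 2^-1 * dot v (H *m v) + dot c v - dot y (A *m v - b)
    + beta / 2 * dot (A *m v - b) (A *m v - b).
  by rewrite /aug_Lagrangian /dot mulmxA.
rewrite !augE /aug_grad !mulmxDr !mulmxDl -!scalemxAl -!mulmxA.
rewrite !(dotDr, dotDl, dotNr, dotNl, dotZr, dotZl).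
have -> : dot x (H *m d) = dot d (H *m x) by rewrite dotC -{1}H_sym dot_trmx.
have At l (u : 'cV[R]_n) (v : 'cV[R]_l) (B : 'M[R]_(l, n)) : dot u (B^T *m v) = dot (B *m u) v.
  by rewrite dot_trmx trmxK.
rewrite !At (dotC c d) (dotC y (A *m d)) (dotC (A *m x) (A *m d)).
rewrite (dotC b (A *m d)) (dotC b (A *m x)).
by field.
Qed.

(** Moving by t along a coordinate of the block is admissible and changes the Lagrangian by a
    nonnegative quadratic in t, whose linear coefficient is that coordinate of the gradient. *)
Lemma block_minimizer_grad0 (w : {set 'I_n}) x y :
  block_minimizer H c A b beta w x y ->
  forall u, u \in w -> aug_grad x y u ord0 = 0.
Proof.
move=> minx u uw; apply: (@quadratic_ge0_linear0 _ _ (2^-1 * S u u)) => t.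
have := minx (x + t *: delta_mx u ord0).
have /[swap]/[apply] : forall u0, u0 \notin w ->
    (x + t *: delta_mx u ord0) u0 ord0 = x u0 ord0.
  move=> u0 u0w; rewrite !mxE (_ : u0 == u = false) ?mulr0 ?addr0 //.
  by apply: contraNF u0w => /eqP ->.
rewrite aug_LagrangianD -addrA lerDl -scalemxAr !dotZl dotZr !dot_delta.
by rewrite -colE [in X in _ <= _ + X]mxE; congr (_ <= _); ring.
Qed.

(** For [v] supported on [w], the rows of [S *m v] in [w] are the diagonal block applied to the
    restriction of [v], and a positive definite block has trivial kernel. *)
Lemma block_pd_ker0 (w : {set 'I_n}) (v : 'cV[R]_n) :
  pdmx (diag_block w H + beta *: ((cols_of w A)^T *m cols_of w A)) ->
  (forall u, u \notin w -> v u ord0 = 0) ->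
  (forall u, u \in w -> (S *m v) u ord0 = 0) -> v = 0.
Proof.
move=> [_ pd] v0 Sv0.
set D := diag_block w H + _ in pd.
set vw : 'cV[R]_#|w| := \col_a v (enum_val a) ord0.
have Dvw : D *m vw = 0.
  apply/matrixP => a j; rewrite {j}(ord1 j) !mxE.
  rewrite -[RHS](Sv0 _ (enum_valP a)) mxE.
  rewrite [RHS](bigID (mem w)) /= [X in _ = _ + X]big1 ?addr0; last first.
    by move=> u /v0 ->; rewrite mulr0.
  rewrite [RHS]big_enum_val; apply: eq_bigr => e _.
  rewrite /D /cols_of /diag_block !mxE; congr ((_ + _ * _) * _).
  by apply: eq_bigr => l _; rewrite !mxE.
have vw0 : vw = 0.
  apply/eqP; apply: contraT => /pd.
  by rewrite -mulmxA Dvw mulmx0 /scal mxE ltxx.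
apply/matrixP => u j; rewrite {j}(ord1 j) [RHS]mxE.
have [uw|/v0 //] := boolP (u \in w).
by have /matrixP/(_ (enum_rank_in uw u) ord0) := vw0; rewrite !mxE enum_rankK_in.
Qed.

Section Order.
Context {p s : nat}.
Variable sg : ordering n p.
Hypothesis sgG : sg \in Gamma_RAC n p s.
Hypothesis blocks_pd : forall w : {set 'I_n}, #|w| = s ->
  pdmx (diag_block w H + beta *: ((cols_of w A)^T *m cols_of w A)).
Local Notation L := (L_mx H A beta sg).

Lemma Gamma_card i : #|sg i| = s.
Proof. by move: sgG; rewrite inE => /and3P[/forallP/(_ i)/eqP]. Qed.

Lemma Gamma_cover u : exists i, u \in sg i.
Proof.
move: sgG; rewrite inE => /and3P[_ _ /eqP cov].
by have : u \in (\bigcup_i sg i)%SET; [rewrite cov inE | case/finset.bigcupP => i; exists i].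
Qed.

Lemma Gamma_inj u i j : u \in sg i -> u \in sg j -> i = j.
Proof.
move: sgG; rewrite inE => /and3P[_ /forallP/(_ i)/forallP/(_ j) dis _] ui uj.
apply/eqP; apply: contraT => ij; move: dis; rewrite ij /=.
by rewrite disjoint_subset => /fintype.subsetP/(_ _ ui); rewrite inE uj.
Qed.

(** Disjointness of the blocks fixes the row block; what remains is exactly the test on columns that
    [sweep] uses. *)
Lemma L_mxE i u v : u \in sg i ->
  L u v = if [exists j : 'I_p, (j <= i)%N && (v \in sg j)] then S u v else 0.
Proof.
move=> ui; rewrite !mxE; congr (if _ then _ else _).
apply/existsP/existsP => [[i' /existsP[j /and3P[ui' vj ji]]]|[j /andP[ji vj]]].
  by exists j; rewrite (Gamma_inj ui ui') ji vj.
by exists i; apply/existsP; exists j; rewrite ui vj ji.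
Qed.

(* L_sigma is block lower triangular along sigma, with positive definite diagonal
   blocks. *)
Lemma L_unit : L \in unitmx.
Proof.
apply: unitmx_ker0 => v Lv.
suff v0 : forall (k : nat) (i : 'I_p), i = k :> nat ->
    forall u, u \in sg i -> v u ord0 = 0.
  apply/matrixP => u j; rewrite (ord1 j) [RHS]mxE.
  by have [i ui] := Gamma_cover u; apply: (v0 _ i).
(* Forward substitution: the earlier blocks of [v] vanish by induction and the later ones have zero
   coefficients, so in the rows of block [i] only the diagonal block acts. *)
elim/ltn_ind => k IH i ik u ui.
set v' : 'cV[R]_n := \col_x if x \in sg i then v x ord0 else 0.
have : v' = 0.
  apply: (block_pd_ker0 (w := sg i)).
  - exact: blocks_pd (Gamma_card i).
  - by move=> x /negbTE xi; rewrite mxE xi.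
  - move=> x xi; have /matrixP/(_ x ord0) := Lv; rewrite mxE [RHS]mxE => Lvx.
    rewrite -[RHS]Lvx mxE; apply: eq_bigr => y _.
    rewrite (L_mxE _ xi) [v' _ _]mxE.
    case: ifPn => [yi|yi].
      by case: ifP => // /existsP[]; exists i; rewrite leqnn yi.
    rewrite mulr0; case: ifP => [/existsP[j /andP[ji yj]]|]; last by rewrite mul0r.
    rewrite (IH j _ j) ?mulr0 //.
    rewrite -ik ltn_neqAle ji andbT; apply: contraNN yi => /eqP/val_inj <-.
    exact: yj.
by move=> /matrixP/(_ u ord0); rewrite !mxE ui.
Qed.

Lemma Lbar_unit : Lbar_mx H A beta sg \in unitmx.
Proof.
by rewrite unitmxE /Lbar_mx det_lblock det1 mulr1 -unitmxE; exact: L_unit.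
Qed.

(** In row [u], columns of blocks up to [i] carry the new values and there L = S, R = 0; the other
    columns carry the old values and there L = 0, R = - S. *)
Lemma sweep_mul i u x x' : u \in sg i ->
  (S *m sweep sg x x' i) u ord0 = (L *m x' - R_mx H A beta sg *m x) u ord0.
Proof.
move=> ui; rewrite /R_mx [in RHS]mulmxBl opprB.
rewrite ![in RHS]mxE [in LHS]mxE -!sumrB -big_split /=.
apply: eq_bigr => v _; rewrite (L_mxE _ ui) [sweep _ _ _ _ _ _]mxE.
by case: ifP => _; rewrite ?mul0r ?subr0 ?add0r // subrr addr0.
Qed.

Definition bbar : 'cV[R]_(n + m) := col_mx (beta *: (A^T *m b) - c) (beta *: b).

Definition stack (z : 'cV[R]_n * 'cV[R]_m) : 'cV[R]_(n + m) := col_mx z.1 z.2.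

(** Each coordinate [u] lies in some block [i]; its gradient vanishes at the i-th sweep, and
    [sweep_mul] turns this into row [u] of the upper half. The lower half is the multiplier
    update. *)
Lemma RAC_ADMM_step_linear z z' : RAC_ADMM_step H c A b beta sg z z' ->
  Lbar_mx H A beta sg *m stack z' = Rbar_mx H A beta sg *m stack z + bbar.
Proof.
move=> [minz y']; rewrite /Lbar_mx /Rbar_mx /stack /bbar !mul_block_col add_col_mx.
congr col_mx; last first.
  rewrite y' !mul1mx mul0mx add0r -scalemxAl.
  by apply/matrixP => u j; rewrite !mxE; ring.
rewrite mul0mx addr0; apply/matrixP => u j; rewrite (ord1 j).
have [i ui] := Gamma_cover u.
have := block_minimizer_grad0 (minz i) ui.
rewrite /aug_grad ![in X in X = 0 -> _]mxE.
have := sweep_mul z.1 z'.1 ui; rewrite [LHS]mxE => ->.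
rewrite ![(_ + _ : 'cV_n) _ _]mxE ![(- _ : 'cV_n) _ _]mxE.
rewrite ![(_ *: _ : 'cV_n) _ _]mxE ![(A^T *m _ : 'cV_n) _ _]mxE.
by move=> ?; lra.
Qed.

(** Since L - R = S, the upper half says S x = A^T y + beta A^T b - c, which is stationarity once A
    x = b. *)
Lemma KKT_fixed z : H *m z.1 + c - A^T *m z.2 = 0 -> A *m z.1 = b ->
  Lbar_mx H A beta sg *m stack z = Rbar_mx H A beta sg *m stack z + bbar.
Proof.
move=> /eqP; rewrite subr_eq0 => /eqP stat feas.
rewrite /Lbar_mx /Rbar_mx /stack /bbar !mul_block_col add_col_mx.
congr col_mx; last by rewrite mul1mx mul0mx add0r -scalemxAl feas addrC.
rewrite mul0mx addr0 /R_mx mulmxBl mulmxDl -scalemxAl -mulmxA feas -stat.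
by apply/matrixP => u j; rewrite !mxE; ring.
Qed.
End Order.
End Algebra.

(** * Averages of tensor squares over words of matrices *)

Section SecondMoment.
Context {R : realType} {I : finType}.
Variable G : {set I}.

(** The possible histories of length [k], as an explicit list, so that expectations become finite
    sums. *)
Fixpoint words k : seq (seq I) :=
  if k is k'.+1 then [seq g :: w | g <- enum G, w <- words k'] else [:: [::]].

Lemma mem_words k w : (w \in words k) = (size w == k) && all (mem G) w.
Proof.
elim: k w => [|k IH] w; first by rewrite inE; case: w.
apply/allpairsP/idP => [[[g v] /= [gG vk ->]]|].
  by move: vk gG; rewrite IH mem_enum /= eqSS => /andP[-> ->] ->.
case: w => [//|g w] /=; rewrite eqSS => /and3P[wk gG wG].
by exists (g, w); rewrite mem_enum gG IH wk wG.
Qed.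

Lemma uniq_words k : uniq (words k).
Proof.
elim: k => //= k IH; apply: allpairs_uniq => //; first exact: enum_uniq.
by move=> [g w] [g' w'] _ _ /= [-> ->].
Qed.

Context {l : nat}.
Variable M : I -> 'M[R]_l.

(** The head of [w] acts first: a word is read in the order of the iterations. *)
Definition run (e : 'cV[R]_l) (w : seq I) : 'cV[R]_l := foldl (fun v g => M g *m v) e w.

Definition tensor_square (e : 'cV[R]_l) : 'cV[R]_(l * l) := e *t e.

Lemma tensor_square_mul (B : 'M[R]_l) e :
  tensor_square (B *m e) = (B *t B) *m tensor_square e.
Proof. by rewrite /tensor_square -tensmx_mul. Qed.

Lemma tensor_square_diag e i :
  tensor_square e (mxtens_index (i, i)) ord0 = e i ord0 ^+ 2.
Proof.
by rewrite expr2 -(tensmxE e e) /tensor_square; congr (tensmx _ _ _ _); exact/val_inj.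
Qed.

(** The abstract form of [E_MM], to which it unfolds for [Gamma_RAC] and [M_mx]. *)
Definition mean_tensor : 'M[R]_(l * l) :=
  (#|G|%:R)^-1 *: \sum_(g in G) (M g *t M g).

(** The weight is the probability of a word of independent uniform letters. Averaging over the first
    letter is one application of [mean_tensor], and the remaining iterate, being linear, commutes
    with that average. *)
Lemma sum_tensor_run k e :
  \sum_(w <- words k) (#|G|%:R^-1) ^+ k *: tensor_square (run e w) =
  iter k (mulmx mean_tensor) (tensor_square e).
Proof.
elim: k e => [|k IH] e; first by rewrite big_seq1 scale1r.
have iter_lin (J : Type) (r : seq J) (F : J -> 'cV[R]_(l * l)) a :
    a *: \sum_(j <- r) iter k (mulmx mean_tensor) (F j) =
    iter k (mulmx mean_tensor) (a *: \sum_(j <- r) F j).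
  elim: k {IH} => //= k <-.
  by rewrite -mulmx_sumr scalemxAr.
rewrite iterSr /mean_tensor -/mean_tensor -scalemxAl mulmx_suml.
under [in RHS]eq_bigr => g _ do rewrite -tensor_square_mul.
rewrite -big_enum -iter_lin /= big_allpairs_dep /= scaler_sumr.
apply: eq_bigr => g _; rewrite -IH scaler_sumr.
by apply: eq_bigr => w _; rewrite exprS scalerA.
Qed.

Lemma mean_square_run k e i :
  \sum_(w <- words k) run e w i ord0 ^+ 2 * (#|G|%:R^-1) ^+ k =
  iter k (mulmx mean_tensor) (tensor_square e) (mxtens_index (i, i)) ord0.
Proof.
rewrite -sum_tensor_run summxE; apply: eq_bigr => w _.
by rewrite mxE tensor_square_diag mulrC.
Qed.

(** The tensor square of [e] has a constant orbit, and a constant sequence with bounded partial sums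
    is 0. *)
Lemma fixed_vector_eq0 (e : 'cV[R]_l) : (0 < #|G|)%N -> spectral_radius mean_tensor < 1 ->
  (forall g, g \in G -> M g *m e = e) -> e = 0.
Proof.
move=> G0 rho fixe.
have iterE k : iter k (mulmx mean_tensor) (tensor_square e) = tensor_square e.
  elim: k => //= k ->; rewrite /mean_tensor -scalemxAl mulmx_suml.
  under eq_bigr => g gG do rewrite -tensor_square_mul fixe //.
  rewrite sumr_const -[tensor_square e *+ _]scaler_nat scalerA mulVf ?scale1r //.
  by rewrite pnatr_eq0 -lt0n.
apply/matrixP => i j; rewrite {j}(ord1 j) [RHS]mxE.
have [B sumB] := summable_orbit (tensor_square e) (mxtens_index (i, i)) rho.
apply/eqP; rewrite -sqrf_eq0; apply: contraT => e0.
have e2_gt0 : 0 < e i ord0 ^+ 2 by rewrite lt_def e0 sqr_ge0.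
(* This many equal terms push the partial sum above [B]. *)
have := sumB (Num.truncn (B / e i ord0 ^+ 2)).+1.
under eq_bigr do rewrite iterE tensor_square_diag ger0_norm ?sqr_ge0 //.
rewrite sumr_const_nat subn0 -mulr_natl -ler_pdivlMr // leNgt.
by rewrite truncnS_gt.
Qed.
End SecondMoment.

(** * Law of the history of random orders *)

Section Histories.
Context {R : realType} {d : measure_display} {T : measurableType d}.
Variables (P : probability T R) (I : finType) (G : {set I}) (X : nat -> T -> I).
Hypothesis X_iid : iid_uniform P G X.

Definition history k t : seq I := mkseq (X^~ t) k.

Lemma history_words k t : history k t \in words G k.
Proof.
rewrite mem_words size_mkseq eqxx; apply/allP => _ /mapP[j _ ->].
by have [XG _ _ _] := X_iid; exact: XG.
Qed.

(* Taking x itself as the default value of nth avoids choosing a point of I. *)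
Lemma history_eq k w : size w = k ->
  [set t | history k t = w] =
  \bigcap_(j in [set` [fset j in iota 0 k]%fset])
    (X j @^-1` [set x | nth x w j = x]).
Proof.
move=> wk; apply/seteqP; split => t /=.
  move=> <- j /=; rewrite inE mem_iota add0n => /andP[_ jk].
  by rewrite nth_mkseq.
move=> Xw; apply: (@eq_from_nth _ (X 0%N t)); first by rewrite size_mkseq wk.
rewrite size_mkseq => j jk; rewrite nth_mkseq // -Xw /=.
  by apply: set_nth_default; rewrite wk.
by rewrite inE mem_iota.
Qed.

(** Rewrites the event as a singleton, the form in which [iid_uniform] gives measurability and
    probability. *)
Lemma nth_fixE w j (x0 : I) : (j < size w)%N ->
  [set x | nth x w j = x] = [set nth x0 w j].
Proof.
by move=> jw; apply/seteqP; split => x /=; rewrite (set_nth_default x0) //.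
Qed.

Lemma measurable_history k w : measurable [set t | history k t = w].
Proof.
have [wk|wk] := eqVneq (size w) k; last first.
  rewrite (_ : [set t | _] = set0) //; apply/seteqP; split => // t /= hw.
  by move: wk; rewrite -hw size_mkseq eqxx.
rewrite (history_eq wk).
apply: bigcap_measurableType => j /=; rewrite inE mem_iota add0n => /andP[_ jk].
case: w wk jk => [<- //|x0 w] wk jk.
by rewrite (nth_fixE x0) ?wk //; have [_ mX _ _] := X_iid; exact: mX.
Qed.

(** Independence splits the event into [k] factors, each equal to 1/|G|. *)
Lemma prob_history k w : w \in words G k ->
  P [set t | history k t = w] = ((#|G|%:R^-1) ^+ k)%:E.
Proof.
rewrite mem_words => /andP[/eqP wk wG]; rewrite (history_eq wk).
have [_ _ unifX ->] := X_iid.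
rewrite (perm_big (iota 0 k)) /=; last first.
  apply: uniq_perm; [exact: fset_uniq | exact: iota_uniq | by move=> j; rewrite inE].
rewrite big_seq (eq_bigr (fun=> ((#|G|%:R)^-1)%:E)) -?big_seq.
  rewrite prodEFin; congr _%:E.
  by rewrite big_const_seq count_predT size_iota iter_mulr_1.
move=> j; rewrite mem_iota add0n => /andP[_ jk].
case: w wk wG jk => [<- //|x0 w] wk wG jk.
rewrite (nth_fixE x0) ?wk // unifX //.
by apply: (allP wG); rewrite mem_nth ?wk.
Qed.

(** A function of the history is a simple function, which reduces its measurability and its integral
    to finite sums. *)
Lemma history_indic (f : seq I -> R) k t :
  f (history k t) = \sum_(w <- words G k) f w * \1_[set t | history k t = w] t.
Proof.
rewrite (bigD1_seq (history k t)) ?history_words ?uniq_words //=.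
rewrite indicE mem_set // mulr1 big1 ?addr0 // => w /eqP wh.
by rewrite indicE memNset ?mulr0 // => /esym.
Qed.

Lemma measurable_history_fun (f : seq I -> R) k :
  measurable_fun [set: T] (fun t => f (history k t) : R).
Proof.
under eq_fun do rewrite history_indic.
apply: measurable_sum => w; apply: measurable_funM => //.
exact/measurable_indic/measurable_history.
Qed.

Lemma integral_history (f : seq I -> R) k : (forall w, 0 <= f w) ->
  (\int[P]_t (f (history k t))%:E =
   (\sum_(w <- words G k) f w * (#|G|%:R^-1) ^+ k)%:E)%E.
Proof.
move=> f0; under eq_integral do rewrite history_indic -sumEFin.
rewrite ge0_integral_sum //; first last.
- by move=> w t _; rewrite lee_fin mulr_ge0 // indicE.
- move=> w; apply/measurable_EFinP/measurable_funM => //.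
  exact/measurable_indic/measurable_history.
rewrite -sumEFin big_seq [RHS]big_seq; apply: eq_bigr => w wG.
under eq_integral do rewrite EFinM.
rewrite ge0_integralZl_EFin //; last first.
  exact/measurable_EFinP/measurable_indic/measurable_history.
rewrite integral_indic //; last exact: measurable_history.
by rewrite setIT EFinM; congr (_ * _)%E; exact: prob_history.
Qed.
End Histories.

(** * Almost sure decay of the error *)

Section AlmostSureDecay.
Context {R : realType} {d : measure_display} {T : measurableType d}.
Variable P : probability T R.

(** By Tonelli the series of the [q k] has integral at most [B], so it is finite almost everywhere,
    and the terms of a convergent series tend to 0. *)
Lemma ae_cvg0_of_summable_integral (q : nat -> T -> R) (B : R) :
  (forall k, measurable_fun [set: T] (q k)) -> (forall k t, 0 <= q k t) ->
  (forall K, \sum_(0 <= k < K) \int[P]_t (q k t)%:E <= B%:E)%E ->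
  {ae P, forall t, q k t @[k --> \oo] --> (0 : R)}.
Proof.
move=> mq q0 sumB.
have mqE k : measurable_fun [set: T] (EFin \o q k) by exact/measurable_EFinP.
have sum_int : P.-integrable [set: T] (fun t => \sum_(0 <= k <oo) (q k t)%:E)%E.
  apply/integrableP; split.
    apply: (@ge0_emeasurable_sum _ _ _ _ (fun k t => (q k t)%:E) xpredT).
      by move=> k t _ _; rewrite lee_fin.
    by move=> k _; exact: mqE.
  rewrite (eq_integral (fun t => \sum_(0 <= k <oo) (q k t)%:E)%E); last first.
    by move=> t _; rewrite gee0_abs //; apply: nneseries_ge0 => k _ _; rewrite lee_fin.
  rewrite integral_nneseries //; last by move=> k t _; rewrite lee_fin.
  apply: le_lt_trans (ltry B); apply: lime_le.
    apply: is_cvg_nneseries => k _ _.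
    by apply: integral_ge0 => t _; rewrite lee_fin.
  by near=> K; exact: sumB.
have := integrable_ae measurableT sum_int.
apply: filterS => t /(_ I) sfin; apply: cvg_series_cvg_0.
apply: nondecreasing_is_cvgn.
  by apply/nondecreasing_seqP => k; rewrite /series /= big_nat_recr //= lerDl.
(* The finite value of the series is a real bound for its partial sums. *)
exists (fine (\sum_(0 <= k <oo) (q k t)%:E)%E) => _ [K _ <-].
rewrite -lee_fin fineK // -sumEFin.
by apply: nneseries_lim_ge => k _ _; rewrite lee_fin.
Unshelve. all: by end_near.
Qed.

Lemma cvg_sqr0 (u : nat -> R) :
  u k ^+ 2 @[k --> \oo] --> (0 : R) -> u k @[k --> \oo] --> (0 : R).
Proof.
move=> /cvgrPdist_lt u2; apply/cvgrPdist_lt => e e0.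
have := u2 (e ^+ 2); rewrite exprn_gt0 // => /(_ isT).
apply: filterS => k; rewrite !sub0r !normrN normrX.
by rewrite ltr_pXn2r // nnegrE ?normr_ge0 // ltW.
Qed.

Context {I : finType} {G : {set I}} {X : nat -> T -> I}.
Hypothesis X_iid : iid_uniform P G X.

(** The second moments of coordinate [i] are the diagonal entries (i, i) of the orbit of the tensor
    square, hence summable; the finitely many almost sure events are then intersected. *)
Lemma ae_run_history_cvg0 l (M : I -> 'M[R]_l) (e : 'cV[R]_l) :
  spectral_radius (mean_tensor G M) < 1 ->
  {ae P, forall t, forall i, run M e (history X k t) i ord0 @[k --> \oo] --> (0 : R)}.
Proof.
move=> rho; apply: filter_forall => i.
have [B sumB] := summable_orbit (tensor_square e) (mxtens_index (i, i)) rho.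
have := @ae_cvg0_of_summable_integral
  (fun k t => run M e (history X k t) i ord0 ^+ 2) B.
case.
- by move=> k; exact: (measurable_history_fun X_iid (fun w => run M e w i ord0 ^+ 2)).
- by move=> k t; exact: sqr_ge0.
- move=> K; under eq_bigr => k _.
    rewrite (integral_history X_iid (f := fun w => run M e w i ord0 ^+ 2));
      last by move=> w; exact: sqr_ge0.
    rewrite mean_square_run; over.
  rewrite sumEFin lee_fin; apply: le_trans (sumB K).
  by apply: ler_sum => k _; exact: ler_norm.
by move=> N [mN N0 sub]; exists N; split => // t nt; apply: sub => /cvg_sqr0.
Qed.
End AlmostSureDecay.

Lemma cvg_mx_coord (R : realType) a b (u : nat -> 'M[R]_(a, b)) (v : 'M[R]_(a, b)) :
  (forall i j, u k i j @[k --> \oo] --> v i j) -> u k @[k --> \oo] --> v.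
Proof.
move=> uv; apply/cvg_ballP => e e0.
have : \forall k \near \oo, forall i j, ball (v i j) e (u k i j).
  by apply: filter_forall => i; apply: filter_forall => j; have /cvg_ballP := uv i j; exact.
by apply: filterS => k uve; split.
Qed.

(** * Existence of a KKT point and the error recursion *)

Section FixedPoint.
Context {R : realType} {n m : nat}.
Variables (H : 'M[R]_n) (c : 'cV[R]_n) (A : 'M[R]_(m, n)) (b : 'cV[R]_m).
Variable beta : R.
Context {p s : nat}.
Hypothesis blocks_pd : forall w : {set 'I_n}, #|w| = s ->
  pdmx (diag_block w H + beta *: ((cols_of w A)^T *m cols_of w A)).

(** The assumptions are the KKT system of the problem with c = 0 and b = 0, for which the constant
    term [bbar] vanishes. *)
Lemma M_mx_KKT_ker sg (x : 'cV[R]_n) (y : 'cV[R]_m) : sg \in Gamma_RAC n p s ->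
  H *m x - A^T *m y = 0 -> A *m x = 0 ->
  M_mx H A beta sg *m col_mx x y = col_mx x y.
Proof.
move=> sgG Kx Ax; rewrite /M_mx -mulmxA.
have := @KKT_fixed _ _ _ H 0 A 0 beta _ sg (x, y).
rewrite /= addr0 /bbar !mulmx0 !scaler0 subr0 col_mx0 addr0.
by move=> /(_ Kx Ax) <-; rewrite mulKmx // (Lbar_unit sgG blocks_pd).
Qed.

(* A vector in the kernel of the KKT matrix is fixed by every M_sigma, so its
   tensor square is fixed by E(M (x) M), whose spectral radius is below 1. *)
Lemma KKT_point_exists : (0 < #|Gamma_RAC n p s|)%N ->
  spectral_radius (E_MM H A beta p s) < 1 -> exists z, KKT_point H c A b z.
Proof.
move=> G0 rho.
(* With this sign the matrix sends (x; y) to (H x - A^T y; A x), so a KKT point solves the system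
   with right-hand side (- c; b). *)
have Kunit : block_mx H (- A^T) A 0 \in unitmx.
  apply: unitmx_ker0 => v; rewrite -[v]vsubmxK mul_block_col mul0mx addr0 mulNmx.
  move=> /eqP; rewrite col_mx_eq0 => /andP[/eqP Kx /eqP Ax].
  apply: (fixed_vector_eq0 G0 rho) => sg sgG.
  exact: M_mx_KKT_ker.
set w := invmx (block_mx H (- A^T) A 0) *m col_mx (- c) b.
exists (usubmx w, dsubmx w); have : block_mx H (- A^T) A 0 *m w = col_mx (- c) b.
  by rewrite /w mulKVmx.
rewrite -{1}[w]vsubmxK mul_block_col mul0mx addr0 mulNmx => /eq_col_mx[Kx Ax].
by split => //=; rewrite addrAC Kx addNr.
Qed.

(** Iterate and KKT point satisfy the same affine equation; subtracting cancels [bbar]. *)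
Lemma RAC_ADMM_step_error sg z z' zs : H^T = H -> sg \in Gamma_RAC n p s ->
  KKT_point H c A b zs -> RAC_ADMM_step H c A b beta sg z z' ->
  stack z' - stack zs = M_mx H A beta sg *m (stack z - stack zs).
Proof.
move=> H_sym sgG [stat feas] /(RAC_ADMM_step_linear H_sym sgG) zz'.
have zsE := KKT_fixed beta sg stat feas.
rewrite /M_mx -mulmxA mulmxBr.
have -> : Rbar_mx H A beta sg *m stack z - Rbar_mx H A beta sg *m stack zs =
    Lbar_mx H A beta sg *m (stack z' - stack zs).
  by rewrite mulmxBr zz' zsE opprD addrACA subrr addr0.
by rewrite mulKmx // (Lbar_unit sgG blocks_pd).
Qed.
End FixedPoint.

(** * Almost sure convergence of the iterates *)

Unset Implicit Arguments.

Theorem theorem2p5 (R : realType) (n m p s : nat)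
    (p_gt0 : (0 < p)%N) (s_gt0 : (0 < s)%N) (n_eq : n = (p * s)%N)
    (H : 'M[R]_n) (c : 'cV[R]_n) (A : 'M[R]_(m, n)) (b : 'cV[R]_m) (beta : R)
    (H_psd : psdmx H) (beta_gt0 : 0 < beta)
    (blocks_pd : forall w : {set 'I_n}, #|w| = s ->
       pdmx (diag_block w H + beta *: ((cols_of w A)^T *m cols_of w A)))
    (rho_lt1 : spectral_radius (E_MM H A beta p s) < 1)
    (d : measure_display) (T : measurableType d) (P : probability T R)
    (z0 : 'cV[R]_n * 'cV[R]_m) (z : nat -> T -> 'cV[R]_n * 'cV[R]_m)
    (z_RAC : RAC_ADMM_process P H c A b beta p s z0 z) :
  exists zstar : 'cV[R]_n * 'cV[R]_m,
    KKT_point H c A b zstar /\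
    {ae P, forall t, z k t @[k --> \oo] --> zstar}.
Proof.
have [H_sym _] := H_psd.
have [sg [X_iid z_init z_step]] := z_RAC.
have [XG _ _ _] := X_iid.
(* A space of total mass 1 is inhabited, and any outcome supplies an order in [Gamma_RAC]. *)
have [t0 _] : [set: T] !=set0.
  apply/set0P/eqP => T0; have := probability_setT P.
  by rewrite T0 measure0 => /eqP; rewrite eq_sym onee_eq0.
have G0 : (0 < #|Gamma_RAC n p s|)%N.
  by apply/card_gt0P; exists (sg 0%N t0).
have [zs zs_KKT] := KKT_point_exists c b blocks_pd G0 rho_lt1.
exists zs; split => //.
set e0 := stack z0 - stack zs.
(* The order drawn at step [k] is appended to the history, and [run] applies it last. *)
have errE k t : stack (z k t) - stack zs = run (M_mx H A beta) e0 (history sg k t).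
  elim: k => [|k IH]; first by rewrite z_init.
  rewrite (RAC_ADMM_step_error blocks_pd H_sym (XG k t) zs_KKT (z_step k t)) IH.
  by rewrite /history mkseqS /run foldl_rcons.
have := ae_run_history_cvg0 X_iid e0 rho_lt1.
apply: filterS => t run0.
have stack_cvg i : stack (z k t) i ord0 @[k --> \oo] --> stack zs i ord0.
  rewrite -[X in _ --> X]add0r.
  rewrite (_ : (fun k => _) = fun k => run (M_mx H A beta) e0 (history sg k t) i ord0
      + stack zs i ord0).
    exact: (cvgD (run0 i) (cvg_cst _)).
  by apply/funext => k; rewrite -errE !mxE subrK.
rewrite [zs]surjective_pairing.
under eq_fun do rewrite [z _ _]surjective_pairing.
apply: (@cvg_pair _ _ _ \oo (nbhs zs.1) (nbhs zs.2)); apply: cvg_mx_coord => i j; rewrite (ord1 j).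
  by have := stack_cvg (lshift m i); rewrite col_mxEu; under eq_fun do rewrite col_mxEu.
by have := stack_cvg (rshift n i); rewrite col_mxEd; under eq_fun do rewrite col_mxEd.
Qed.
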